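(* Let $\mathbf a:\mathbb R^D\to\mathcal H$ satisfy $\langle\mathbf a(\theta),\mathbf a(\theta')\rangle=e^{-\lambda\|\theta-\theta'\|_p^p}$ with $\lambda>0$, $0<p\le1$. Let $\mathcal S^\star=\{\theta^\star_\ell\}_{\ell=1}^k\subset\mathbb R^D$ be pairwise distinct and $\Delta_0=\min_{d\in\{1,\dots,D\}}\min\{|\theta^\star_\ell[d]-\theta^\star_{\ell'}[d]|:\ \ell,\ell'\in\{1,\dots,k\},\ \theta^\star_\ell[d]\ne\theta^\star_{\ell'}[d]\}$ (with $\min\emptyset=+\infty$). If $\Delta_0^p\ge\log(2k-1)/\lambda$, then for every $\mathcal S\subseteq\mathcal S^\star$, OMP achieves exact $\mathrm{card}(\mathcal S)$-step recovery of $\mathcal S$.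
   Context: $\|\theta\|_p^p=\sum_d|\theta[d]|^p$; $\mathcal H$ real Hilbert space. OMP with input $\mathbf y$: $\mathbf r=\mathbf y$, $\widehat{\mathcal S}=\emptyset$; while $\mathbf r\ne0$: choose any $\widehat\theta_t\in\arg\max_\theta|\langle\mathbf a(\theta),\mathbf r\rangle|$, add it to $\widehat{\mathcal S}$, set $\mathbf r$ to $\mathbf y$ minus its orthogonal projection onto $\mathrm{span}\{\mathbf a(\widehat\theta_1),\dots,\mathbf a(\widehat\theta_t)\}$. A reachable support is any final $\widehat{\mathcal S}$ obtainable through some sequence of choices of maximizers. OMP achieves exact $m$-step recovery of $\mathcal S=\{\vartheta_1,\dots,\vartheta_m\}$ if for all nonzero reals $c_1,\dots,c_m$ every reachable support of OMP with input $\sum_{j}c_j\mathbf a(\vartheta_j)$ equals $\mathcal S$ (trivial for $\mathcal S=\emptyset$). *)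

(* Defs.v *)
From mathcomp Require Import all_boot.
From Stdlib Require Import Reals.
Set Implicit Arguments. Unset Strict Implicit. Unset Printing Implicit Defensive.
Open Scope R_scope.

Record RHilbert := {
  hcar :> Type;
  hadd : hcar -> hcar -> hcar;
  hscal : R -> hcar -> hcar;
  hzero : hcar;
  hopp : hcar -> hcar;
  hinner : hcar -> hcar -> R;
  hadd_assoc : forall x y z, hadd x (hadd y z) = hadd (hadd x y) z;
  hadd_comm : forall x y, hadd x y = hadd y x;
  hadd_0 : forall x, hadd x hzero = x;
  hadd_opp : forall x, hadd x (hopp x) = hzero;
  hscal_1 : forall x, hscal 1 x = x;
  hscal_assoc : forall a b x, hscal a (hscal b x) = hscal (a * b) x;
  hscal_distr_v : forall a x y, hscal a (hadd x y) = hadd (hscal a x) (hscal a y);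
  hscal_distr_s : forall a b x, hscal (a + b) x = hadd (hscal a x) (hscal b x);
  hinner_sym : forall x y, hinner x y = hinner y x;
  hinner_add : forall x y z, hinner (hadd x y) z = hinner x z + hinner y z;
  hinner_scal : forall a x y, hinner (hscal a x) y = a * hinner x y;
  hinner_pos : forall x, 0 <= hinner x x;
  hinner_def : forall x, hinner x x = 0 -> x = hzero;
  hcomplete : forall u : nat -> hcar,
    (forall eps, eps > 0 -> exists N, forall m n, (N <= m)%nat -> (N <= n)%nat ->
        sqrt (hinner (hadd (u m) (hopp (u n))) (hadd (u m) (hopp (u n)))) < eps) ->
    exists l, forall eps, eps > 0 -> exists N, forall n, (N <= n)%nat ->
        sqrt (hinner (hadd (u n) (hopp l)) (hadd (u n) (hopp l))) < eps
}.

Definition hsub (H : RHilbert) (x y : H) : H := hadd x (hopp y).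

Definition point (D : nat) := 'I_D -> R.

(** t^p for t >= 0, real p > 0 (with 0^p = 0). *)
Definition powp (t p : R) : R :=
  match Rlt_dec 0 t with left _ => Rpower t p | right _ => 0 end.

Definition normpp (D : nat) (v : point D) (p : R) : R :=
  \big[Rplus/R0]_(d < D) powp (Rabs (v d)) p.

Definition psub (D : nat) (u v : point D) : point D := fun d => u d - v d.

Fixpoint lincomb (H : RHilbert) (D : nat) (a : point D -> H)
    (cs : list R) (sel : list (point D)) : H :=
  match cs, sel with
  | c :: cs', t :: sel' => hadd (hscal c (a t)) (lincomb a cs' sel')
  | _, _ => hzero H
  end.

(** r is y minus its orthogonal projection onto span{a(t) | t in sel}. *)
Definition is_residual (H : RHilbert) (D : nat) (a : point D -> H)
    (y : H) (sel : list (point D)) (r : H) : Prop :=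
  (exists cs : list R, length cs = length sel /\ r = hsub y (lincomb a cs sel))
  /\ (forall t, List.In t sel -> hinner r (a t) = 0).

Definition is_argmax (H : RHilbert) (D : nat) (a : point D -> H) (r : H) (t : point D) :=
  forall t' : point D, Rabs (hinner (a t') r) <= Rabs (hinner (a t) r).

Inductive omp_reach (H : RHilbert) (D : nat) (a : point D -> H) (y : H) :
    list (point D) -> Prop :=
| omp_start : omp_reach a y nil
| omp_step : forall sel r t,
    omp_reach a y sel -> is_residual a y sel r -> r <> hzero H ->
    is_argmax a r t -> omp_reach a y (sel ++ t :: nil).

(** Final reachable selections (loop exits because the residual is 0);
    the reachable support is the set of points in such a list. *)
Definition omp_final (H : RHilbert) (D : nat) (a : point D -> H) (y : H)
    (sel : list (point D)) : Prop :=
  omp_reach a y sel /\ is_residual a y sel (hzero H).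

Definition omp_exact_recovery (H : RHilbert) (D k : nat) (a : point D -> H)
    (ths : 'I_k -> point D) (S : {set 'I_k}) : Prop :=
  forall c : 'I_k -> R, (forall l, l \in S -> c l <> 0) ->
  forall sel, omp_final a (\big[@hadd H/hzero H]_(l in S) hscal (c l) (a (ths l))) sel ->
  forall t, List.In t sel <-> exists l, l \in S /\ t = ths l.

(** Delta_0: minimum nonzero coordinate gap; None encodes +infinity (min of empty). *)
Definition gaps (D k : nat) (ths : 'I_k -> point D) : seq R :=
  flatten [seq flatten [seq [seq Rabs (ths l d - ths l' d)
            | l' <- enum 'I_k & (if Req_EM_T (ths l d) (ths l' d) then false else true)]
          | l <- enum 'I_k] | d <- enum 'I_D].

Definition Delta0 (D k : nat) (ths : 'I_k -> point D) : option R :=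
  foldr (fun x acc => match acc with None => Some x | Some m => Some (Rmin x m) end)
        None (gaps ths).

(* Main.v *)
(** The correlation [f v = <a v, r>] of a residual is a combination of translates of a product
    kernel [prod_d psi |v d - t d|], where [psi t = exp (- lam * t^p)] is convex, decreasing and
    supermultiplicative because [p <= 1], and distinct coordinates of the atoms satisfy
    [psi gap <= mu = 1 / (2 k - 1)].

    A maximizer of [|f|] has all its coordinates on the grid of atom coordinates.  Indeed, along a
    coordinate line, let [x] lie between neighbouring nodes [x1 < x < x2] and compare [h x] with
    [al * h x1 + be * h x2], where the weights make the comparison exact for the kernel sections
    at [x1] and [x2].  Convexity bounds the error at every other node by a multiple of
    [1 - al - be], and diagonal dominance, [max |h| >= k mu max |V|], shows that the gain
    [(1 - al - be) max |h|] beats the total error.  A grid point that is not an atom of the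
    support correlates at most [mu] with each atom, hence loses to the atom of largest weight.
    So only atoms of the support are selected, and linear independence of the atoms (diagonal
    dominance again) forces all of them to be selected before the residual vanishes. *)
Require Import Defs.
From HB Require Import structures.
From mathcomp Require Import all_boot.
From Stdlib Require Import Reals Lra FunctionalExtensionality Classical.
Open Scope R_scope.

(** * Finite sums of real numbers *)

HB.instance Definition _ := Monoid.isComLaw.Build R 0 Rplus
  (fun x y z => esym (Rplus_assoc x y z)) Rplus_comm Rplus_0_l.
HB.instance Definition _ := Monoid.isComLaw.Build R 1 Rmult
  (fun x y z => esym (Rmult_assoc x y z)) Rmult_comm Rmult_1_l.
HB.instance Definition _ := Monoid.isMulLaw.Build R 0 Rmult
  Rmult_0_l Rmult_0_r.
HB.instance Definition _ := Monoid.isAddLaw.Build R Rmult Rplus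
  Rmult_plus_distr_r Rmult_plus_distr_l.

Local Notation "\rsum_ ( i | P ) F" := (\big[Rplus/0]_(i | P) F)
  (at level 41, F at level 41, i, P at level 50).
Lemma Rsum_le (I : finType) (P : pred I) (F G : I -> R) :
  (forall i, P i -> F i <= G i) -> \rsum_(i | P i) F i <= \rsum_(i | P i) G i.
Proof. by move=> h; elim/big_ind2: _ => [|*|//]; lra. Qed.

Lemma Rabs_sum_le (I : finType) (P : pred I) (F : I -> R) :
  Rabs (\rsum_(i | P i) F i) <= \rsum_(i | P i) Rabs (F i).
Proof.
elim/big_ind2: _ => [|x x' y y' h h'|*]; [rewrite Rabs_R0; lra| |lra].
by have := Rabs_triang x' y'; lra.
Qed.

Lemma Rsum_const (I : finType) (P : pred I) (c : R) :
  \rsum_(i | P i) c = INR #|P| * c.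
Proof.
rewrite big_const; elim: #|P| => [|n IH]; first by rewrite /=; lra.
by rewrite iterS IH S_INR; lra.
Qed.

(** Used with [X] the nodes at which a comparison is exact. Indices outside [P] are counted too, at
    no harm since [0 <= c]. *)
Lemma Rabs_sum_bound (I : finType) (P : pred I) (X : {set I}) (F : I -> R) (c : R) :
  0 <= c -> (forall i, P i -> i \in X -> F i = 0) ->
  (forall i, P i -> i \notin X -> Rabs (F i) <= c) ->
  Rabs (\rsum_(i | P i) F i) <= (INR #|I| - INR #|X|) * c.
Proof.
move=> c0 FX Fc; apply: Rle_trans (Rabs_sum_le _ _ _) _.
have -> : (INR #|I| - INR #|X|) * c = \rsum_(i | i \notin X) c.
  rewrite Rsum_const -(cardC X) plus_INR.
  by rewrite (@eq_card _ (fun i => i \notin X) [predC X]) //; lra.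
rewrite big_mkcond [X in _ <= X]big_mkcond; apply: Rsum_le => i _.
case: ifP => Pi; case: ifP => Xi; [exact: Fc| |lra|lra].
by rewrite FX ?Rabs_R0; [lra| |move/negbFE: Xi].
Qed.

Lemma finite_argmax (I : finType) (P : pred I) (F : I -> R) (i0 : I) :
  P i0 -> exists2 i, P i & forall j, P j -> F j <= F i.
Proof.
move=> Pi0.
suff [i Pi hi] : exists2 i, P i & forall j, j \in enum I -> P j -> F j <= F i.
  by exists i => // j; apply: hi; rewrite mem_enum.
elim: (enum I) => [|j s [i Pi hi]]; first by exists i0.
case Pj : (P j); last first.
  by exists i => // l; rewrite inE => /orP [/eqP ->|/hi //]; rewrite Pj.
case: (Rle_lt_dec (F j) (F i)) => ji.
  by exists i => // l; rewrite inE => /orP [/eqP ->|/hi //].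
exists j => // l; rewrite inE => /orP [/eqP -> _|ls Pl]; first lra.
by have := hi l ls Pl; lra.
Qed.

(** * Convex decreasing kernels on the half-line and the kernel [exp (- lam * t^p)] *)

(** Convexity is required on [[0, +oo)] only: [psi |x|] has a kink at the origin. It is stated for
    the points [u < u + t < u + t + s] with denominators cleared. *)
Record cusp_kernel (psi : R -> R) : Prop := {
  cusp0 : psi 0 = 1;
  cusp_gt0 : forall t, 0 < psi t;
  cusp_decr : forall s t, 0 <= s -> s < t -> psi t < psi s;
  cusp_mul : forall s t, 0 <= s -> 0 <= t -> psi s * psi t <= psi (s + t);
  cusp_convex : forall u s t, 0 <= u -> 0 < s -> 0 < t ->
    (s + t) * psi (u + t) <= s * psi u + t * psi (u + t + s) }.

Lemma cusp_noninc (psi : R -> R) (s t : R) :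
  cusp_kernel psi -> 0 <= s -> s <= t -> psi t <= psi s.
Proof.
move=> K s0 [st|->]; last lra.
by have := cusp_decr _ K s t s0 st; lra.
Qed.

Lemma cusp_le1 (psi : R -> R) (t : R) : cusp_kernel psi -> 0 <= t -> psi t <= 1.
Proof. by move=> K t0; rewrite -(cusp0 _ K); apply: cusp_noninc => //; lra. Qed.

Lemma exp_tangent (x y : R) : exp x * (1 + (y - x)) <= exp y.
Proof.
have -> : exp y = exp x * exp (y - x) by rewrite -exp_plus; f_equal; lra.
apply: Rmult_le_compat_l; [exact/Rlt_le/exp_pos|].
exact: exp_ineq1_le.
Qed.

(** The tangent of [exp] at [p * ln x], evaluated at [0] and at [ln x] and averaged with weights
    [1 - p] and [p]: the slope terms cancel. *)
Lemma Rpower_bernoulli (x p : R) : 0 < x -> 0 < p -> p <= 1 ->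
  Rpower x p <= 1 + p * (x - 1).
Proof.
move=> x0 p0 p1; rewrite /Rpower.
have := exp_tangent (p * ln x) (ln x); have := exp_tangent (p * ln x) 0.
rewrite exp_0 exp_ln //; set E := exp _; set L := ln x => h0 h1.
nra.
Qed.

(** Dividing by [z] reduces this to the Bernoulli inequality. That needs a positive base, so [x = 0]
    is separate and amounts to [0 <= 1 - p]. *)
Lemma powp_tangent (x z p : R) : 0 <= x -> 0 < z -> 0 < p -> p <= 1 ->
  powp x p <= powp z p + p * (powp z p / z) * (x - z).
Proof.
move=> x0 z0 p0 p1; rewrite /powp; case: (Rlt_dec 0 z) => // _.
have Z0 : 0 < Rpower z p by exact: exp_pos.
case: (Rlt_dec 0 x) => [xp|xn].
  have xz : 0 < x / z by exact: Rdiv_lt_0_compat.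
  have -> : Rpower x p = Rpower z p * Rpower (x / z) p.
    rewrite Rpower_mult_distr //.
    by have -> : z * (x / z) = x by field; lra.
  have -> : Rpower z p + p * (Rpower z p / z) * (x - z)
            = Rpower z p * (1 + p * (x / z - 1)) by field; lra.
  by apply: Rmult_le_compat_l; [lra|exact: Rpower_bernoulli].
have -> : x = 0 by lra.
have -> : Rpower z p + p * (Rpower z p / z) * (0 - z) = Rpower z p * (1 - p) by field; lra.
by apply: Rmult_le_pos; lra.
Qed.

(** Both outer points are compared with the tangent at [u + t]; with weights [s] and [t] the slope
    terms cancel. *)
Lemma powp_concave (u s t p : R) : 0 < p -> p <= 1 -> 0 <= u -> 0 < s -> 0 < t ->
  s * powp u p + t * powp (u + t + s) p <= (s + t) * powp (u + t) p.
Proof.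
move=> p0 p1 u0 s0 t0.
have z0 : 0 < u + t by lra.
have := powp_tangent u (u + t) p u0 z0 p0 p1.
have x0 : 0 <= u + t + s by lra.
have := powp_tangent (u + t + s) (u + t) p x0 z0 p0 p1.
set q := p * _; move=> h1 h2.
have := Rmult_le_compat_l s _ _ (Rlt_le _ _ s0) h2.
have := Rmult_le_compat_l t _ _ (Rlt_le _ _ t0) h1.
by nra.
Qed.

Lemma powp0 (p : R) : powp 0 p = 0.
Proof. by rewrite /powp; case: (Rlt_dec 0 0) => // h; lra. Qed.

Lemma powp_incr (s t p : R) : 0 < p -> 0 <= s -> s < t -> powp s p < powp t p.
Proof.
move=> p0 s0 st; rewrite /powp; case: (Rlt_dec 0 t) => [t0|]; last lra.
case: (Rlt_dec 0 s) => [sp|_]; last exact: exp_pos.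
by apply: exp_increasing; apply: Rmult_lt_compat_l => //; apply: ln_increasing.
Qed.

Lemma powp_le (s t p : R) : 0 < p -> s <= t -> powp s p <= powp t p.
Proof.
move=> p0 [st|->]; last lra.
case: (Rle_lt_dec 0 s) => [s0|s0]; first by have := powp_incr s t p p0 s0 st; lra.
rewrite {1}/powp; case: (Rlt_dec 0 s) => [|_]; first lra.
by rewrite /powp; case: (Rlt_dec 0 t) => _; [exact/Rlt_le/exp_pos|lra].
Qed.

(** A concave function vanishing at [0] lies above its chord from [0] to [s + t]; the chord values
    at [s] and [t] add up to its value at [s + t]. *)
Lemma powp_subadd (s t p : R) : 0 < p -> p <= 1 -> 0 <= s -> 0 <= t ->
  powp (s + t) p <= powp s p + powp t p.
Proof.
move=> p0 p1 [s0|<-]; last by rewrite powp0 Rplus_0_l; lra.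
move=> [t0|<-]; last by rewrite powp0 Rplus_0_r; lra.
have := powp_concave 0 s t p p0 p1 (Rle_refl 0) s0 t0.
have := powp_concave 0 t s p p0 p1 (Rle_refl 0) t0 s0.
rewrite !Rplus_0_l powp0 (Rplus_comm t s) => h1 h2.
apply: (Rmult_le_reg_l (s + t)); first lra.
by lra.
Qed.

Lemma exp_powp_cusp (lam p : R) : 0 < lam -> 0 < p -> p <= 1 ->
  cusp_kernel (fun t => exp (- lam * powp t p)).
Proof.
move=> l0 p0 p1; split => [|t|s t s0 st|s t s0 t0|u s t u0 s0 t0].
- by rewrite powp0 Rmult_0_r exp_0.
- exact: exp_pos.
- by apply: exp_increasing; have := powp_incr s t p p0 s0 st; nra.
- rewrite -exp_plus.
  have := powp_subadd s t p p0 p1 s0 t0 => h.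
  have : - lam * powp s p + - lam * powp t p <= - lam * powp (s + t) p by nra.
  by case=> [/exp_increasing|->]; lra.
- have h := powp_concave u s t p p0 p1 u0 s0 t0.
  set z := powp (u + t) p in h *.
  have h1 := exp_tangent (- lam * z) (- lam * powp u p).
  have h2 := exp_tangent (- lam * z) (- lam * powp (u + t + s) p).
  have E0 := exp_pos (- lam * z).
  set E := exp (- lam * z) in h1 h2 E0 *.
  set A := powp u p in h h1 *; set B := powp (u + t + s) p in h h2 *.
  have k1 := Rmult_le_compat_l s _ _ (Rlt_le _ _ s0) h1.
  have k2 := Rmult_le_compat_l t _ _ (Rlt_le _ _ t0) h2.
  (* The tangents of [exp] at the middle value leave this slope term, which is the concavity defect
     of [t^p] times a positive factor. *)
  have : 0 <= (E * lam) * ((s + t) * z - (s * A + t * B)).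
    by apply: Rmult_le_pos; nra.
  by nra.
Qed.

(** * Interpolation of kernel sections from two nodes *)

(** Weight of the node at distance [t] in the minimum-norm interpolation at a point between two
    nodes, the other one being at distance [s]; it solves [interp_weight_solves]. *)
Definition interp_weight (psi : R -> R) (t s : R) : R :=
  (psi t - psi (t + s) * psi s) / (1 - psi (t + s) * psi (t + s)).

Lemma cusp_bounds (psi : R -> R) (s t : R) : cusp_kernel psi -> 0 < s -> 0 < t ->
  [/\ 0 < psi (t + s), psi (t + s) < psi t, psi t < 1 & psi t * psi s <= psi (t + s)].
Proof.
move=> K s0 t0; split.
- exact: cusp_gt0 K _.
- by apply: (cusp_decr _ K); lra.
- by rewrite -(cusp0 _ K); apply: (cusp_decr _ K); lra.
- by apply: (cusp_mul _ K); lra.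
Qed.

(** One row of the 2 by 2 system expressing exactness at the two nodes; exchanging [s] and [t] gives
    the other row. *)
Lemma interp_weight_solves (psi : R -> R) (s t : R) : cusp_kernel psi -> 0 < s -> 0 < t ->
  interp_weight psi t s + interp_weight psi s t * psi (t + s) = psi t.
Proof.
move=> K s0 t0; have [m0 m1 y1 _] := cusp_bounds psi s t K s0 t0.
rewrite /interp_weight (Rplus_comm s t); field.
by nra.
Qed.

Lemma interp_weight_ge0 (psi : R -> R) (s t : R) : cusp_kernel psi -> 0 < s -> 0 < t ->
  0 <= interp_weight psi t s.
Proof.
move=> K s0 t0; have [m0 m1 y1 _] := cusp_bounds psi s t K s0 t0.
have [_ _ y2 _] := cusp_bounds psi t s K t0 s0.
have := cusp_gt0 _ K s.
move=> ys; apply: Rmult_le_pos; first by nra.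
by apply/Rlt_le/Rinv_0_lt_compat; nra.
Qed.

(** The sum of the two rows. It ties the gain [1 - al - be] to the constant in [interp_error]. *)
Lemma interp_weight_sum (psi : R -> R) (s t : R) : cusp_kernel psi -> 0 < s -> 0 < t ->
  (1 + psi (t + s)) * (1 - interp_weight psi t s - interp_weight psi s t)
  = 1 + psi (t + s) - psi t - psi s.
Proof.
move=> K s0 t0; have [m0 m1 y1 _] := cusp_bounds psi s t K s0 t0.
rewrite /interp_weight (Rplus_comm s t); field.
by nra.
Qed.

(** The kernel centre lies at distance [u] beyond the node at distance [t] from the evaluation
    point. By [interp_weight_sum] the bound is [(1 + m) * (1 - al - be) * psi u] with
    [m = psi (t + s)]. The upper estimate comes from convexity, the lower one from
    supermultiplicativity and [m <= 1 / 3]. *)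
Lemma interp_error (psi : R -> R) (u s t : R) : cusp_kernel psi ->
  0 <= u -> 0 < s -> 0 < t -> psi (t + s) <= 1 / 3 ->
  Rabs (psi (u + t) - interp_weight psi t s * psi u - interp_weight psi s t * psi (u + t + s))
  <= (1 + psi (t + s) - psi t - psi s) * psi u.
Proof.
move=> K u0 s0 t0 m3.
have [m0 m1 y11 ym] := cusp_bounds psi s t K s0 t0.
have [_ m2 y21 _] := cusp_bounds psi t s K t0 s0.
rewrite (Rplus_comm s t) in m2.
have a0 := interp_weight_ge0 psi s t K s0 t0.
have b0 := interp_weight_ge0 psi t s K t0 s0.
have E1 := interp_weight_solves psi s t K s0 t0.
have E2 := interp_weight_solves psi t s K t0 s0.
rewrite (Rplus_comm s t) in E2.
have c1 := cusp_convex _ K u s t u0 s0 t0.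
have := cusp_convex _ K 0 t s (Rle_refl 0) t0 s0.
rewrite !Rplus_0_l (cusp0 _ K) (Rplus_comm s t) => c2.
have d1 : psi (u + t + s) <= psi (u + t) by apply: cusp_noninc => //; lra.
have d2 : psi (u + t) <= psi u by apply: cusp_noninc => //; lra.
have e1 : psi (t + s) * psi u <= psi (u + t + s).
  by rewrite Rmult_comm Rplus_assoc; apply: (cusp_mul _ K); lra.
have e2 : psi t * psi u <= psi (u + t).
  by rewrite Rmult_comm; apply: (cusp_mul _ K); lra.
have g0 := cusp_gt0 _ K u.
(* [T = t / (t + s)] serves two chords: the one over [[u, u + t + s]] at [u + t], and the one over
   [[0, t + s]] at [s], where it weights [psi 0 = 1]. *)
have [T T0 [ET1 ET2]] : exists2 T, 0 <= T <= 1 &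
    psi (u + t) <= (1 - T) * psi u + T * psi (u + t + s) /\
    psi s <= (1 - T) * psi (t + s) + T.
  have ts : 0 < t + s by lra.
  have Es : s / (t + s) = 1 - t / (t + s) by field; lra.
  exists (t / (t + s)).
    split; first by apply/Rlt_le/Rdiv_lt_0_compat.
    have : 0 < s / (t + s) by exact: Rdiv_lt_0_compat.
    by lra.
  rewrite -Es; split; apply: (Rmult_le_reg_l (t + s)) => //.
    have -> : (t + s) * (s / (t + s) * psi u + t / (t + s) * psi (u + t + s))
      = s * psi u + t * psi (u + t + s) by field; lra.
    by lra.
  have -> : (t + s) * (s / (t + s) * psi (t + s) + t / (t + s))
      = s * psi (t + s) + t by field; lra.
  by lra.
move: E1 E2 a0 b0 c1 c2 d1 d2 e1 e2 g0 ET1 ET2 m0 m1 m2 m3 y11 y21 ym.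
set al := interp_weight psi t s; set be := interp_weight psi s t.
set m := psi (t + s); set y1 := psi t; set y2 := psi s.
set g := psi u; set gt := psi (u + t); set gG := psi (u + t + s).
move=> E1 E2 a0 b0 _ _ d1 d2 e1 e2 g0 ET1 ET2 m0 m1 m2 m3 y11 y21 ym.
have S : (1 + m) * (1 - al - be) = 1 + m - y1 - y2 by lra.
have A0 : 0 < 1 + m - y1 - y2 by nra.
have A1 : 0 <= 1 - al - be.
  by apply: (Rmult_le_reg_l (1 + m)); lra.
have A2 : 1 - al - be <= 1 + m - y1 - y2.
  by have := Rmult_le_pos m _ (Rlt_le _ _ m0) A1; lra.
have B2 : (1 - m * m) * be = y2 - m * y1.
  have : m * (al + be * m) = m * y1 by rewrite E1. lra.
apply: Rabs_le; split.
(* Lower bound. Use [gt >= y1 * g] if [gG <= y1 * g], and [gt >= gG] otherwise; with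
   [y1 = al + be * m], both cases reduce to [key]. *)
- have be1 : be <= y2.
    by have := Rmult_le_pos al m a0 (Rlt_le _ _ m0); lra.
  have b' : y1 - m <= y1 * (1 - y2) by nra.
  have key : be * (y1 - m) <= 1 + m - y1 - y2.
    have mm : m * m <= 1 / 3 * m by apply: Rmult_le_compat_r; lra.
    have Y0 : 0 <= (1 - y1) * (1 - y2) by apply: Rmult_le_pos; lra.
    have be' : (1 - m * m) * be <= (m + y2) * (1 - y1) by rewrite B2; nra.
    have P1 : ((1 - m * m) * be) * (y1 - m) <= ((m + y2) * (1 - y1)) * (y1 * (1 - y2)).
      apply: Rmult_le_compat => //; [apply: Rmult_le_pos; lra|lra].
    have P2 : ((m + y2) * (1 - y1)) * (y1 * (1 - y2)) <= (m + m) * ((1 - y1) * (1 - y2)).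
      have -> : ((m + y2) * (1 - y1)) * (y1 * (1 - y2))
        = (m * y1 + y1 * y2) * ((1 - y1) * (1 - y2)) by ring.
      apply: Rmult_le_compat_r => //.
      have : m * y1 <= m * 1 by apply: Rmult_le_compat_l; lra. lra.
    have P3 : (1 - y1) * (1 - y2) <= 1 + m - y1 - y2 by lra.
    (* Here [m <= 1 / 3] enters, through [2 m <= 1 - m^2]. *)
    have P4 : (m + m) * ((1 - y1) * (1 - y2)) <= (1 - m * m) * (1 + m - y1 - y2).
      by apply: Rmult_le_compat => //; lra.
    apply: (Rmult_le_reg_l (1 - m * m)); lra.
  have gkey := Rmult_le_compat_l g _ _ (Rlt_le _ _ g0) key.
  have E1g : (al + be * m) * g = y1 * g by rewrite E1.
  have [gy|gy] := Rle_lt_dec gG (y1 * g).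
    have : be * gG <= be * (y1 * g) by exact: Rmult_le_compat_l.
    lra.
  have : y1 * g * (1 - be) <= gG * (1 - be) by apply: Rmult_le_compat_r; nra.
  lra.
- (* Let [T] be the chord parameter. If [be <= T], replace [gG] by its upper bound [g];
     otherwise by its lower bound [m * g]. *)
  have up : gt - al * g - be * gG <= g * (1 - T - al) + gG * (T - be) by lra.
  have [Tb|Tb] := Rle_lt_dec be T.
    have : gG * (T - be) <= g * (T - be) by apply: Rmult_le_compat_r; lra.
    have := Rmult_le_compat_l g _ _ (Rlt_le _ _ g0) A2.
    lra.
  have : m * g * (be - T) <= gG * (be - T) by apply: Rmult_le_compat_r; lra.
  (* The two rows give [(1 - m^2) * be = y2 - m * y1], and the chord at [s] gives
     [y2 - m <= (1 - m) * T]. *)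
  have bT : (1 - m) * (be - T) <= m * (1 - al - be).
    apply: (Rmult_le_reg_l (1 + m)); first lra.
    have := Rmult_le_compat_l (1 + m) _ _ (Rlt_le _ _ (Rplus_lt_0_compat _ _ Rlt_0_1 m0)) ET2.
    have := f_equal (Rmult m) S.
    lra.
  have := Rmult_le_compat_l g _ _ (Rlt_le _ _ g0) bT.
  have := Rmult_le_compat_l g _ _ (Rlt_le _ _ g0) A2.
  rewrite -S; lra.
Qed.

(** * Kernel sums along a coordinate line *)

Definition slice (k : nat) (J : {set 'I_k}) (V xs : 'I_k -> R) (psi : R -> R) (x : R) : R :=
  \rsum_(j | j \in J) (V j * psi (Rabs (x - xs j))).
Arguments slice {k} J V xs psi x.

(** Reflection turns a point left of all nodes into one right of all nodes. *)
Lemma slice_opp (k : nat) (J : {set 'I_k}) (V xs : 'I_k -> R) (psi : R -> R) (x : R) :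
  slice J V (fun j => - xs j) psi (- x) = slice J V xs psi x.
Proof.
apply: eq_bigr => j _; congr (_ * psi _).
by rewrite -(Rabs_Ropp (x - _)); congr Rabs; lra.
Qed.

Lemma slice_interp (k : nat) (J : {set 'I_k}) (V xs : 'I_k -> R) (psi : R -> R)
  (x al x1 be x2 : R) :
  slice J V xs psi x = al * slice J V xs psi x1 + be * slice J V xs psi x2 +
   \rsum_(j | j \in J) (V j * (psi (Rabs (x - xs j)) - al * psi (Rabs (x1 - xs j))
      - be * psi (Rabs (x2 - xs j)))).
Proof.
rewrite /slice !big_distrr -!big_split; apply: eq_bigr => j _ /=; lra.
Qed.

(** The other terms cost at most [(k - 1) * mu * |V i0|], and [(2 k - 1) * mu = 1] says that
    [1 - (k - 1) * mu = k * mu]. *)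
Lemma diag_dominance (k : nat) (P : pred 'I_k) (V kap : 'I_k -> R) (mu : R) (i0 : 'I_k) :
  (2 * INR k - 1) * mu = 1 -> P i0 -> kap i0 = 1 ->
  (forall j, P j -> j != i0 -> 0 <= kap j <= mu) -> 0 <= mu ->
  (forall j, P j -> Rabs (V j) <= Rabs (V i0)) ->
  INR k * mu * Rabs (V i0) <= Rabs (\rsum_(j | P j) (V j * kap j)).
Proof.
move=> hmu Pi0 k1 kmu mu0 hV; rewrite (bigD1 i0) //= k1 Rmult_1_r.
set S := \big[_/_]_(_ | _) _.
have hS : Rabs S <= (INR k - 1) * (Rabs (V i0) * mu).
  have := @Rabs_sum_bound _ (fun j => P j && (j != i0)) [set i0] (fun j => V j * kap j)
    (Rabs (V i0) * mu).
  rewrite card_ord cards1; apply.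
  - by apply: Rmult_le_pos => //; exact: Rabs_pos.
  - by move=> j /andP [_ /negP jn]; rewrite inE.
  - move=> j /andP [Pj jn] _; have [k0 km] := kmu j Pj jn.
    rewrite Rabs_mult (Rabs_pos_eq _ k0).
    by apply: Rmult_le_compat => //; [exact: Rabs_pos|exact: hV].
have := Rabs_triang_inv (V i0) (- S); rewrite Rabs_Ropp /Rminus Ropp_involutive.
have -> : INR k * mu * Rabs (V i0) = Rabs (V i0) - (INR k - 1) * (Rabs (V i0) * mu).
  have -> : Rabs (V i0) - (INR k - 1) * (Rabs (V i0) * mu)
    = Rabs (V i0) * (1 - (INR k - 1) * mu) by ring.
  rewrite -{1}hmu; ring.
lra.
Qed.

Lemma Rabs_interp_lt (h h1 h2 e al be B : R) :
  h = al * h1 + be * h2 + e -> 0 <= al -> 0 <= be -> Rabs h1 <= B -> Rabs h2 <= B ->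
  Rabs e < (1 - al - be) * B -> Rabs h < B.
Proof.
move=> -> al0 be0 b1 b2 be1.
apply: Rle_lt_trans (Rabs_triang _ _) _.
apply: Rle_lt_trans (Rplus_le_compat_r _ _ _ (Rabs_triang _ _)) _.
rewrite !Rabs_mult (Rabs_pos_eq al) // (Rabs_pos_eq be) //.
have := Rmult_le_compat_l al _ _ al0 b1; have := Rmult_le_compat_l be _ _ be0 b2.
lra.
Qed.

(** As [i1] and [i2] are neighbours of [x], every other node lies beyond one of them, at a distance
    [u] with [psi u <= mu], so [interp_error] applies to it. At most [k - 2] such errors compete
    with the gain [(1 - al - be) * B], where [B >= k * mu * M]. *)
Lemma slice_between (k : nat) (J : {set 'I_k}) (V xs : 'I_k -> R) (psi : R -> R)
  (x mu M B : R) (i1 i2 : 'I_k) :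
  cusp_kernel psi -> (2 * INR k - 1) * mu = 1 ->
  (forall i j, i \in J -> j \in J -> i != j -> psi (Rabs (xs i - xs j)) <= mu) ->
  i1 \in J -> i2 \in J -> xs i1 < x < xs i2 ->
  (forall j, j \in J -> xs j < x -> xs j <= xs i1) ->
  (forall j, j \in J -> x < xs j -> xs i2 <= xs j) ->
  (forall j, j \in J -> xs j <> x) ->
  0 < M -> (forall j, j \in J -> Rabs (V j) <= M) -> INR k * mu * M <= B ->
  Rabs (slice J V xs psi (xs i1)) <= B -> Rabs (slice J V xs psi (xs i2)) <= B ->
  Rabs (slice J V xs psi x) < B.
Proof.
move=> K hmu gap J1 J2 [x1 x2] near1 near2 xJ M0 hM MB B1 B2.
have i12 : i1 != i2 by apply/eqP => E; rewrite E in x1; lra.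
(* Two distinct nodes force [k >= 2], hence [mu <= 1 / 3], as [interp_error] requires. *)
have k2 : 2 <= INR k.
  have := max_card (mem [set i1; i2]).
  by rewrite cards2 i12 card_ord => /leP/le_INR /=; lra.
have mu0 : 0 < mu by nra.
have mu3 : mu <= 1 / 3 by nra.
set t := x - xs i1; set s := xs i2 - x.
have t0 : 0 < t by rewrite /t; lra.
have s0 : 0 < s by rewrite /s; lra.
have Ets : xs i2 - xs i1 = t + s by rewrite /t /s; ring.
have ts : psi (t + s) <= mu.
  have := gap i2 i1 J2 J1; rewrite eq_sym i12 => /(_ isT).
  by rewrite Ets Rabs_pos_eq //; lra.
have [m0 m1 y11 ym] := cusp_bounds psi s t K s0 t0.
have [_ m2 y21 _] := cusp_bounds psi t s K t0 s0.
rewrite (Rplus_comm s t) in m2.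
have a0 := interp_weight_ge0 psi s t K s0 t0.
have b0 := interp_weight_ge0 psi t s K t0 s0.
have E1 := interp_weight_solves psi s t K s0 t0.
have E2 := interp_weight_solves psi t s K t0 s0.
have ES := interp_weight_sum psi s t K s0 t0.
rewrite (Rplus_comm s t) in E2.
set c := 1 + psi (t + s) - psi t - psi s in ES.
have c0 : 0 < c.
  have : 0 < (1 - psi t) * (1 - psi s) by apply: Rmult_lt_0_compat; lra.
  by rewrite /c; lra.
apply: (Rabs_interp_lt _ _ _ _ _ _ _ (slice_interp k J V xs psi x
   (interp_weight psi t s) (xs i1) (interp_weight psi s t) (xs i2))) => //.
set e := \big[_/_]_(_ | _) _.
have he : Rabs e <= (INR k - 2) * (M * (c * mu)).
  have := @Rabs_sum_bound _ (mem J) [set i1; i2] (fun j => V j * (psi (Rabs (x - xs j))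
     - interp_weight psi t s * psi (Rabs (xs i1 - xs j))
     - interp_weight psi s t * psi (Rabs (xs i2 - xs j)))) (M * (c * mu)).
  rewrite card_ord cards2 i12; apply.
  - by apply: Rmult_le_pos; [lra|apply: Rmult_le_pos; lra].
  - move=> j _; rewrite !inE => /orP [] /eqP ->.
      rewrite Ets -/t !Rabs_pos_eq; try lra.
      by rewrite Rminus_diag (cusp0 _ K) -{1}E1; ring.
    have -> : x - xs i2 = - s by rewrite /s; ring.
    have -> : xs i1 - xs i2 = - (t + s) by rewrite /t /s; ring.
    rewrite !Rabs_Ropp Rminus_diag Rabs_R0 (cusp0 _ K) !Rabs_pos_eq; try lra.
    by rewrite -{1}E2; ring.
  - move=> j jJ; rewrite !inE negb_or => /andP [j1 j2].
    rewrite Rabs_mult; apply: Rmult_le_compat; [exact: Rabs_pos|exact: Rabs_pos|exact: hM|].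
    case: (Rlt_le_dec (xs j) x) => jx.
      have u0 := near1 j jJ jx.
      have := gap i1 j J1 jJ; rewrite eq_sym j1 => /(_ isT).
      have -> : x - xs j = xs i1 - xs j + t by rewrite /t; ring.
      have -> : xs i2 - xs j = xs i1 - xs j + t + s by rewrite /t /s; ring.
      have : 0 <= xs i1 - xs j by lra.
      move: (xs i1 - xs j) => u {}u0.
      rewrite (Rabs_pos_eq u) // (Rabs_pos_eq (u + t)) ?(Rabs_pos_eq (u + t + s)); try lra.
      move=> g; apply: Rle_trans (interp_error psi u s t K u0 s0 t0 _) _; first lra.
      by apply: Rmult_le_compat_l; lra.
    (* Mirror case: the roles of [s] and [t], and of the two weights, are exchanged. *)
    have jx' : x < xs j by have := xJ j jJ; lra.
    have u0 := near2 j jJ jx'.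
    have := gap j i2 jJ J2; rewrite j2 => /(_ isT).
    rewrite (Rabs_minus_sym x) (Rabs_minus_sym (xs i1)) (Rabs_minus_sym (xs i2)).
    have -> : xs j - x = xs j - xs i2 + s by rewrite /s; ring.
    have -> : xs j - xs i1 = xs j - xs i2 + s + t by rewrite /t /s; ring.
    have : 0 <= xs j - xs i2 by lra.
    move: (xs j - xs i2) => u {}u0.
    rewrite (Rabs_pos_eq u) // (Rabs_pos_eq (u + s)) ?(Rabs_pos_eq (u + s + t)); try lra.
    move=> g; have := interp_error psi u t s K u0 t0 s0.
    rewrite (Rplus_comm s t) => hh.
    have -> : forall p q r : R, p - q - r = p - r - q by move=> *; ring.
    apply: Rle_trans (hh _) _; first lra.
    have -> : 1 + psi (t + s) - psi s - psi t = c by rewrite /c; ring.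
    by apply: Rmult_le_compat_l; lra.
apply: Rle_lt_trans he _.
set A := 1 - _ - _ in ES *.
have A0 : 0 < A by apply: (Rmult_lt_reg_l (1 + psi (t + s))); lra.
have : A * (INR k * mu * M) <= A * B by apply: Rmult_le_compat_l; lra.
(* What remains is [(k - 2) (1 + m) < k], with [m <= mu = 1 / (2 k - 1)]. *)
suff : (INR k - 2) * (M * (c * mu)) < A * (INR k * mu * M) by lra.
rewrite -ES.
have -> : (INR k - 2) * (M * ((1 + psi (t + s)) * A * mu)) =
  (A * (mu * M)) * ((INR k - 2) * (1 + psi (t + s))) by ring.
have -> : A * (INR k * mu * M) = (A * (mu * M)) * INR k by ring.
apply: Rmult_lt_compat_l; first by apply: Rmult_lt_0_compat => //; apply: Rmult_lt_0_compat.
have : (INR k - 2) * psi (t + s) <= (INR k - 2) * mu by apply: Rmult_le_compat_l; lra.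
lra.
Qed.

(** Beyond the last node [i1] a single weight [psi t] suffices; the second weight is [0]. Since
    [psi u * psi t <= psi (u + t) <= psi u], each other node errs by at most [(1 - psi t) * mu] per
    unit weight, and [k - 1] such errors stay below the gain. *)
Lemma slice_outside (k : nat) (J : {set 'I_k}) (V xs : 'I_k -> R) (psi : R -> R)
  (x mu M B : R) (i1 : 'I_k) :
  cusp_kernel psi -> 0 < mu ->
  (forall i j, i \in J -> j \in J -> i != j -> psi (Rabs (xs i - xs j)) <= mu) ->
  i1 \in J -> xs i1 < x ->
  (forall j, j \in J -> xs j <= xs i1) ->
  0 < M -> (forall j, j \in J -> Rabs (V j) <= M) -> INR k * mu * M <= B ->
  Rabs (slice J V xs psi (xs i1)) <= B ->
  Rabs (slice J V xs psi x) < B.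
Proof.
move=> K mu0 gap J1 x1 near1 M0 hM MB B1.
set t := x - xs i1.
have t0 : 0 < t by rewrite /t; lra.
have y1 : psi t < 1 by rewrite -(cusp0 _ K); apply: (cusp_decr _ K); lra.
have y0 := cusp_gt0 _ K t.
apply: (Rabs_interp_lt _ _ _ _ _ _ _ (slice_interp k J V xs psi x
   (psi t) (xs i1) 0 (xs i1))) => //; try lra.
set e := \big[_/_]_(_ | _) _.
have he : Rabs e <= (INR k - 1) * (M * ((1 - psi t) * mu)).
  have := @Rabs_sum_bound _ (mem J) [set i1] (fun j => V j * (psi (Rabs (x - xs j))
     - psi t * psi (Rabs (xs i1 - xs j)) - 0 * psi (Rabs (xs i1 - xs j))))
     (M * ((1 - psi t) * mu)).
  rewrite card_ord cards1; apply.
  - by apply: Rmult_le_pos; [lra|apply: Rmult_le_pos; lra].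
  - move=> j _; rewrite !inE => /eqP ->.
    rewrite (Rabs_pos_eq (x - _)) -/t; last lra.
    by rewrite Rminus_diag Rabs_R0 (cusp0 _ K); ring.
  - move=> j jJ; rewrite !inE => j1.
    rewrite Rabs_mult; apply: Rmult_le_compat; [exact: Rabs_pos|exact: Rabs_pos|exact: hM|].
    have u0 := near1 j jJ.
    have := gap i1 j J1 jJ; rewrite eq_sym j1 => /(_ isT).
    have -> : x - xs j = xs i1 - xs j + t by rewrite /t; ring.
    have : 0 <= xs i1 - xs j by lra.
    move: (xs i1 - xs j) => u u1.
    rewrite (Rabs_pos_eq u) // (Rabs_pos_eq (u + t)); last lra.
    move=> g.
    have h1 : psi u * psi t <= psi (u + t) by apply: (cusp_mul _ K); lra.
    have h2 : psi (u + t) <= psi u by apply: cusp_noninc => //; lra.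
    have h3 : (1 - psi t) * psi u <= (1 - psi t) * mu by apply: Rmult_le_compat_l; lra.
    by rewrite Rabs_pos_eq; lra.
apply: Rle_lt_trans he _.
have : (1 - psi t) * (INR k * mu * M) <= (1 - psi t) * B by apply: Rmult_le_compat_l; lra.
have : 0 < M * ((1 - psi t) * mu) by apply: Rmult_lt_0_compat => //; apply: Rmult_lt_0_compat; lra.
lra.
Qed.

Lemma exists_weight_neq0 (I : finType) (P : pred I) (V F : I -> R) :
  \rsum_(i | P i) (V i * F i) <> 0 -> exists2 i, P i & V i <> 0.
Proof.
move=> h0; apply: NNPP => hn; apply: h0; apply: big1 => i Pi.
have -> : V i = 0 by apply: NNPP => Vi; apply: hn; exists i.
exact: Rmult_0_l.
Qed.

(** Diagonal dominance at the node of largest weight makes the best node value [B] at least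
    [k * mu * M]. The position of [x] among the nodes then selects [slice_between], [slice_outside],
    or the latter after reflection. *)
Lemma slice_max_distinct (k : nat) (J : {set 'I_k}) (V xs : 'I_k -> R) (psi : R -> R)
  (x mu : R) :
  cusp_kernel psi -> (2 * INR k - 1) * mu = 1 -> 0 < mu ->
  (forall i j, i \in J -> j \in J -> i != j -> psi (Rabs (xs i - xs j)) <= mu) ->
  (forall j, j \in J -> xs j <> x) ->
  slice J V xs psi x <> 0 ->
  exists2 i, i \in J & Rabs (slice J V xs psi x) < Rabs (slice J V xs psi (xs i)).
Proof.
move=> K hmu mu0 gap xJ h0.
have [i iJ Vi] := exists_weight_neq0 _ _ _ _ h0.
have [i0 J0 hM] := finite_argmax _ (mem J) (fun i => Rabs (V i)) i iJ.
have M0 : 0 < Rabs (V i0) by have := hM i iJ; have := Rabs_pos_lt _ Vi; rewrite /=; lra.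
have [l lJ hB] := finite_argmax _ (mem J) (fun i => Rabs (slice J V xs psi (xs i))) i iJ.
exists l => //; move: hB; set B := Rabs (slice J V xs psi (xs l)) => hB.
have MB : INR k * mu * Rabs (V i0) <= B.
  apply: Rle_trans (hB i0 J0); apply: diag_dominance => //; last lra.
    by rewrite Rminus_diag Rabs_R0 (cusp0 _ K).
  move=> j jJ ji; split; first exact/Rlt_le/(cusp_gt0 _ K).
  by apply: gap => //; rewrite eq_sym.
pose lt_x : pred 'I_k := fun j => (j \in J) && (if Rlt_dec (xs j) x then true else false).
pose gt_x : pred 'I_k := fun j => (j \in J) && (if Rlt_dec x (xs j) then true else false).
have ltE j : lt_x j <-> j \in J /\ xs j < x.
  by rewrite /lt_x; case: (j \in J); case: Rlt_dec; split=> // -[].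
have gtE j : gt_x j <-> j \in J /\ x < xs j.
  by rewrite /gt_x; case: (j \in J); case: Rlt_dec; split=> // -[].
have [j0 j0lt|Lempty] := pickP lt_x.
  have [i1 /ltE [J1 x1] near1] := finite_argmax _ lt_x xs j0 j0lt.
  have [j1 j1gt|Rempty] := pickP gt_x.
    have [i2 /gtE [J2 x2] near2] := finite_argmax _ gt_x (fun j => - xs j) j1 j1gt.
    apply: (@slice_between _ _ _ _ _ _ mu (Rabs (V i0)) B i1 i2) => //; try exact: hB.
      by move=> j jJ jx; apply: near1; apply/ltE.
    move=> j jJ jx; have : - xs j <= - xs i2 by apply: near2; apply/gtE.
    by lra.
  apply: (@slice_outside _ _ _ _ _ _ mu (Rabs (V i0)) B i1) => //; try exact: hB.
  move=> j jJ; apply: near1; apply/ltE; split=> //.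
  case: (Rtotal_order (xs j) x) => [//|[/(xJ j jJ) //|jx]].
  by have := Rempty j; rewrite (proj2 (gtE j)).
have J_gt j : j \in J -> gt_x j.
  move=> jJ; apply/gtE; split=> //.
  case: (Rtotal_order (xs j) x) => [jx|[/(xJ j jJ) //|//]].
  by have := Lempty j; rewrite (proj2 (ltE j)).
have [i2 /gtE [J2 x2] near2] := finite_argmax _ gt_x (fun j => - xs j) i (J_gt i iJ).
rewrite -slice_opp.
apply: (@slice_outside _ _ _ _ _ _ mu (Rabs (V i0)) B i2) => //; try lra.
- move=> a b aJ bJ ab; rewrite -Rabs_Ropp.
  have -> : - (- xs a - - xs b) = xs a - xs b by ring.
  exact: gap.
- by move=> j jJ; apply/near2/J_gt.
- by rewrite slice_opp; apply: hB.
Qed.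

(** Distinct atoms may share a coordinate, so positions may coincide here. Merging keeps indices in
    ['I_k], so the same [mu] serves. *)
Lemma slice_max (k : nat) (V xs : 'I_k -> R) (psi : R -> R) (x mu : R) :
  cusp_kernel psi -> (2 * INR k - 1) * mu = 1 -> 0 < mu ->
  (forall i j, xs i <> xs j -> psi (Rabs (xs i - xs j)) <= mu) ->
  (forall j, xs j <> x) ->
  slice setT V xs psi x <> 0 ->
  exists i, Rabs (slice setT V xs psi x) < Rabs (slice setT V xs psi (xs i)).
Proof.
move=> K hmu mu0 gap xJ.
pose same i : pred 'I_k := fun j => if Req_EM_T (xs j) (xs i) then true else false.
have sameP i j : reflect (xs j = xs i) (same i j).
  by rewrite /same; case: Req_EM_T => ?; constructor.
(* The picked predicate depends only on the position [xs i], so equal positions share a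
   representative. As [i] itself satisfies it, the default is never reached. *)
pose rep i := odflt i [pick j | same i j].
have same_eq i i' : xs i = xs i' -> same i =1 same i'.
  by move=> E j; apply/sameP/sameP => ->.
have xs_rep i : xs (rep i) = xs i.
  by rewrite /rep; case: pickP => [j /sameP //|].
have rep_eq i j : xs i = xs j -> rep i = rep j.
  move=> E; rewrite /rep (eq_pick (same_eq _ _ E)); case: pickP => // /(_ i).
  by case: sameP.
pose J := [set rep i | i : 'I_k].
(* Nodes sharing a position are merged into one representative carrying the total weight. *)
pose W j := \rsum_(i | rep i == j) V i.
have sliceE y : slice setT V xs psi y = slice J W xs psi y.
  rewrite /slice (partition_big rep (mem J)) /=; last by move=> i _; exact: imset_f.
  apply: eq_bigr => j jJ; rewrite /W big_distrl /=.
  apply: eq_big => [i|i]; first by rewrite inE.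
  by move=> /andP [_ /eqP <-]; rewrite xs_rep.
rewrite !sliceE => h0.
have [|i _ hi] := slice_max_distinct k J W xs psi x mu K hmu mu0 _ (fun j _ => xJ j) h0.
  move=> i j /imsetP [i' _ ->] /imsetP [j' _ ->] ij; apply: gap.
  by rewrite !xs_rep => E; move/eqP: ij; apply; apply: rep_eq.
by exists i; rewrite [X in _ < Rabs X]sliceE.
Qed.

(** * Product kernels and correlations with the atoms *)

Definition prod_kernel (psi : R -> R) {D : nat} (u v : point D) : R :=
  \big[Rmult/1]_(d < D) psi (Rabs (u d - v d)).

Lemma point_eqVneq (D : nat) (u v : point D) : u = v \/ exists d, u d <> v d.
Proof.
have [|uv] := classic (exists d, u d <> v d); first by right.
left; apply: functional_extensionality => d.
by apply: NNPP => duv; apply: uv; exists d.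
Qed.

Lemma prod_kernel_self (psi : R -> R) (D : nat) (u : point D) :
  cusp_kernel psi -> prod_kernel psi u u = 1.
Proof. by move=> K; apply: big1 => d _; rewrite Rminus_diag Rabs_R0 (cusp0 _ K). Qed.

Lemma prod_cusp_bounds (psi : R -> R) (I : finType) (P : pred I) (F : I -> R) :
  cusp_kernel psi -> 0 < \big[Rmult/1]_(i | P i) psi (Rabs (F i)) <= 1.
Proof.
move=> K; elim/big_ind: _ => [|x y [x0 x1] [y0 y1]|i _]; first lra.
  split; first exact: Rmult_lt_0_compat.
  by rewrite -(Rmult_1_r 1); apply: Rmult_le_compat; lra.
by split; [exact: cusp_gt0|apply: cusp_le1 => //; exact: Rabs_pos].
Qed.

Lemma prod_kernel_le (psi : R -> R) (D : nat) (u v : point D) (d : 'I_D) :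
  cusp_kernel psi -> prod_kernel psi u v <= psi (Rabs (u d - v d)).
Proof.
move=> K; rewrite /prod_kernel (bigD1 d) //=.
have [_ h1] := prod_cusp_bounds psi _ (fun i => i != d) (fun i => u i - v i) K.
have := Rmult_le_compat_l _ _ _ (Rlt_le _ _ (cusp_gt0 _ K (Rabs (u d - v d)))) h1.
by rewrite Rmult_1_r.
Qed.

Lemma prod_kernel_lt1 (psi : R -> R) (D : nat) (u v : point D) :
  cusp_kernel psi -> u <> v -> prod_kernel psi u v < 1.
Proof.
move=> K; have [//|[d uv] _] := point_eqVneq _ u v.
apply: Rle_lt_trans (prod_kernel_le psi _ _ _ d K) _.
rewrite -(cusp0 _ K); apply: (cusp_decr _ K); first lra.
by apply: Rabs_pos_lt; lra.
Qed.

Definition correlation (psi : R -> R) {D k : nat} (ths : 'I_k -> point D) (w : 'I_k -> R)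
  (v : point D) : R := \rsum_(l | true) (w l * prod_kernel psi (ths l) v).

Definition update {D : nat} (v : point D) (d : 'I_D) (x : R) : point D :=
  fun d' => if d' == d then x else v d'.

Lemma update_id (D : nat) (v : point D) (d : 'I_D) : update v d (v d) = v.
Proof. by apply: functional_extensionality => d'; rewrite /update; case: eqP => // ->. Qed.

(** Only the factor in direction [d] varies; the other factors are absorbed into the weights. *)
Lemma correlation_slice (psi : R -> R) (D k : nat) (ths : 'I_k -> point D) (w : 'I_k -> R)
  (v : point D) (d : 'I_D) (x : R) :
  correlation psi ths w (update v d x) =
  slice setT (fun l => w l * \big[Rmult/1]_(d' | d' != d) psi (Rabs (ths l d' - v d')))
    (fun l => ths l d) psi x.
Proof.
rewrite /correlation /slice; apply: eq_big => [l|l _]; first by rewrite inE.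
rewrite /prod_kernel (bigD1 d) //= {1}/update eqxx Rabs_minus_sym.
rewrite (eq_bigr (fun d' => psi (Rabs (ths l d' - v d')))); first by ring.
by move=> d' /negbTE dd; rewrite /update dd.
Qed.

(** In a coordinate where the two points differ, both values are atom coordinates, so that factor is
    at most [mu]; the others are at most [1]. *)
Lemma distinct_prod_kernel_le (psi : R -> R) (D k : nat) (ths : 'I_k -> point D) (mu : R)
  (v : point D) (l : 'I_k) :
  cusp_kernel psi ->
  (forall l l' d, ths l d <> ths l' d -> psi (Rabs (ths l d - ths l' d)) <= mu) ->
  (forall d, exists l, ths l d = v d) -> ths l <> v -> prod_kernel psi (ths l) v <= mu.
Proof.
move=> K gap grid; have [//|[d lv] _] := point_eqVneq _ (ths l) v.
apply: Rle_trans (prod_kernel_le psi _ _ _ d K) _.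
by have [l' l'd] := grid d; move: lv; rewrite -l'd => /gap.
Qed.

(** Diagonal dominance of the Gram matrix. For nonzero weights the lower bound is positive, which
    also gives linear independence of the atoms. *)
Lemma correlation_max_weight (psi : R -> R) (D k : nat) (ths : 'I_k -> point D) (mu : R)
  (w : 'I_k -> R) (l0 : 'I_k) :
  cusp_kernel psi -> (2 * INR k - 1) * mu = 1 -> 0 < mu ->
  (forall l l' d, ths l d <> ths l' d -> psi (Rabs (ths l d - ths l' d)) <= mu) ->
  injective ths -> (forall l, Rabs (w l) <= Rabs (w l0)) ->
  INR k * mu * Rabs (w l0) <= Rabs (correlation psi ths w (ths l0)).
Proof.
move=> K hmu mu0 gap inj hw; apply: diag_dominance => //; last lra.
  exact: prod_kernel_self.
move=> j _ jl; split.
  by have [h _] := prod_cusp_bounds psi _ predT (fun d => ths j d - ths l0 d) K; apply: Rlt_le.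
apply: distinct_prod_kernel_le => //; first by move=> d; exists l0.
by move/inj => E; rewrite E eqxx in jl.
Qed.

Lemma Rabs_le_bounds (x y : R) : Rabs x <= y -> - y <= x <= y.
Proof. by rewrite /Rabs; case: Rcase_abs; lra. Qed.

Lemma grid_correlation_lt (psi : R -> R) (D k : nat) (ths : 'I_k -> point D) (mu : R)
  (w : 'I_k -> R) (v : point D) (l0 : 'I_k) :
  cusp_kernel psi -> (2 * INR k - 1) * mu = 1 -> 0 < mu ->
  (forall l l' d, ths l d <> ths l' d -> psi (Rabs (ths l d - ths l' d)) <= mu) ->
  injective ths -> (forall d, exists l, ths l d = v d) ->
  (forall l, Rabs (w l) <= w l0) -> 0 < w l0 ->
  (forall l, w l <> 0 -> ths l <> v) ->
  Rabs (correlation psi ths w v) < Rabs (correlation psi ths w (ths l0)).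
Proof.
move=> K hmu mu0 gap inj grid hw w0 vS.
have kap0 l u : 0 < prod_kernel psi (ths l) u <= 1 by exact: prod_cusp_bounds.
have far0 l : l != l0 -> prod_kernel psi (ths l) (ths l0) <= mu.
  move=> ll; apply: distinct_prod_kernel_le => //; first by move=> d; exists l0.
  by move/inj => E; rewrite E eqxx in ll.
have farv l : w l <> 0 -> prod_kernel psi (ths l) v <= mu.
  by move=> /vS ?; apply: distinct_prod_kernel_le.
have wn0 : w l0 <> 0 by lra.
have v0 := farv l0 wn0.
have v1 := prod_kernel_lt1 psi _ _ _ K (vS _ wn0).
have [v2 _] := kap0 l0 v.
have wk l : l != l0 -> Rabs (w l * prod_kernel psi (ths l) (ths l0)) <= w l0 * mu.
  move=> ll; rewrite Rabs_mult; have [h _] := kap0 l (ths l0).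
  by rewrite (Rabs_pos_eq _ (Rlt_le _ _ h)); apply: Rmult_le_compat;
    [exact: Rabs_pos|exact: Rlt_le|exact: hw|exact: far0].
rewrite /correlation (bigD1 l0) // [X in _ < Rabs X](bigD1 l0) //= prod_kernel_self // Rmult_1_r.
set A := \big[_/_]_(_ | _) _; set B := \big[_/_]_(_ | _) _.
set k0 := prod_kernel psi (ths l0) v in v0 v1 v2 *.
have bound (F : 'I_k -> R) c : 0 <= c -> (forall l, l != l0 -> Rabs (F l) <= c) ->
    Rabs (\rsum_(l | l != l0) F l) <= (INR k - 1) * c.
  move=> c0 hF; have := @Rabs_sum_bound _ (fun l => l != l0) [set l0] F c c0.
  rewrite card_ord cards1; apply; first by move=> l /negPf ll; rewrite inE ll.
  by move=> l ll _; apply: hF.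
have wm : 0 < w l0 * mu by exact: Rmult_lt_0_compat.
(* Both kernel values lie in [(0, mu]] wherever [w l] is nonzero, so the difference costs no more
   than one sum. Bounding [A] and [B] separately would lose strictness when [k0 = mu]. *)
have BA : Rabs (\rsum_(l | l != l0) (w l * prod_kernel psi (ths l) (ths l0)
    + -1 * (w l * prod_kernel psi (ths l) v))) <= (INR k - 1) * (w l0 * mu).
  apply: bound => [|l ll]; first lra.
  have -> : w l * prod_kernel psi (ths l) (ths l0) + -1 * (w l * prod_kernel psi (ths l) v)
    = w l * (prod_kernel psi (ths l) (ths l0) - prod_kernel psi (ths l) v) by ring.
  case: (Req_EM_T (w l) 0) => [->|wl]; first by rewrite Rmult_0_l Rabs_R0; lra.
  rewrite Rabs_mult; apply: Rmult_le_compat; [exact: Rabs_pos|exact: Rabs_pos|exact: hw|].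
  have [h1 _] := kap0 l (ths l0); have [h2 _] := kap0 l v.
  by have := far0 l ll; have := farv l wl; move=> *; apply: Rabs_le; lra.
have Ab : Rabs A <= (INR k - 1) * (w l0 * mu).
  apply: bound => [|l ll]; first lra.
  case: (Req_EM_T (w l) 0) => [->|wl]; first by rewrite Rmult_0_l Rabs_R0; lra.
  rewrite Rabs_mult; have [h _] := kap0 l v.
  by rewrite (Rabs_pos_eq _ (Rlt_le _ _ h)); apply: Rmult_le_compat;
    [exact: Rabs_pos|exact: Rlt_le|exact: hw|exact: farv].
have Bb : Rabs B <= (INR k - 1) * (w l0 * mu) by apply: bound => //; lra.
rewrite big_split -big_distrr /= -/A -/B in BA.
have E : (INR k - 1) * (w l0 * mu) = w l0 * ((1 - mu) / 2).
  have -> : (INR k - 1) * (w l0 * mu) = w l0 * ((2 * INR k - 1) * mu - mu) / 2 by field.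
  by rewrite hmu; field.
rewrite E in BA Ab Bb.
have mu1 : w l0 * k0 <= w l0 * mu by apply: Rmult_le_compat_l; lra.
(* For [k = 1] one has [mu = 1], and strictness rests on [k0 < 1]. *)
have mu2 : w l0 * k0 < w l0 * 1 by apply: Rmult_lt_compat_l; lra.
have mu3 : 0 < w l0 * k0 by apply: Rmult_lt_0_compat.
move/Rabs_le_bounds: BA => BA; move/Rabs_le_bounds: Ab => Ab; move/Rabs_le_bounds: Bb => Bb.
rewrite (Rabs_pos_eq (w l0 + B)); last lra.
by apply: Rabs_def1; lra.
Qed.

Lemma correlation_opp (psi : R -> R) (D k : nat) (ths : 'I_k -> point D) (w : 'I_k -> R)
  (v : point D) : correlation psi ths (fun l => - w l) v = - correlation psi ths w v.
Proof.
rewrite /correlation (big_morph Ropp Ropp_plus_distr Ropp_0).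
by apply: eq_bigr => l _; ring.
Qed.

Lemma argmax_in_support (psi : R -> R) (D k : nat) (ths : 'I_k -> point D) (mu : R)
  (w : 'I_k -> R) (v : point D) (l1 : 'I_k) :
  cusp_kernel psi -> (2 * INR k - 1) * mu = 1 -> 0 < mu ->
  (forall l l' d, ths l d <> ths l' d -> psi (Rabs (ths l d - ths l' d)) <= mu) ->
  injective ths -> w l1 <> 0 ->
  (forall u, Rabs (correlation psi ths w u) <= Rabs (correlation psi ths w v)) ->
  exists l, w l <> 0 /\ v = ths l.
Proof.
move=> K hmu mu0 gap inj w1 vmax.
have [l0 _ hw] := finite_argmax _ predT (fun l => Rabs (w l)) l1 isT.
have w0 : 0 < Rabs (w l0) by have := hw l1 isT; have := Rabs_pos_lt _ w1; rewrite /=; lra.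
have k0 : 1 <= INR k by have /ltP/le_INR := ltn_ord l1; rewrite S_INR; have := pos_INR l1; lra.
have f0 : correlation psi ths w v <> 0.
  move=> fv; have := vmax (ths l0); rewrite fv Rabs_R0.
  have := correlation_max_weight psi _ _ ths mu w l0 K hmu mu0 gap inj (fun l => hw l isT).
  have : 0 < INR k * mu * Rabs (w l0) by apply: Rmult_lt_0_compat => //; apply: Rmult_lt_0_compat; lra.
  lra.
(* A coordinate of [v] off the grid could be moved to an atom coordinate with a strictly larger
   correlation. *)
have grid d : exists l, ths l d = v d.
  apply: NNPP => hn.
  have off l : ths l d <> v d by move=> E; apply: hn; exists l.
  have := correlation_slice psi _ _ ths w v d; set V := (fun _ => _ * _) => fs.
  have [||i] := slice_max k V (fun l => ths l d) psi (v d) mu K hmu mu0 _ off.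
  - by move=> i j; apply: gap.
  - by rewrite -fs update_id.
  by rewrite -!fs update_id; have := vmax (update v d (ths i d)); lra.
have [//|hn] := classic (exists l, w l <> 0 /\ v = ths l).
have off l : w l <> 0 -> ths l <> v by move=> wl E; apply: hn; exists l.
(* [grid_correlation_lt] wants a positive largest weight; otherwise all weights are negated. *)
have := vmax (ths l0); case: (Rlt_le_dec (w l0) 0) => wl0.
  have := grid_correlation_lt psi _ _ ths mu (fun l => - w l) v l0 K hmu mu0 gap inj grid.
  rewrite !correlation_opp !Rabs_Ropp => h hle; exfalso.
  apply: (Rlt_not_le _ _ (h _ _ _)) => //; last 1 first.
  - by move=> l wl; apply: off; lra.
  - by move=> l; rewrite Rabs_Ropp -(Rabs_left (w l0)) //; apply: hw.
  - by lra.
have w0' : 0 < w l0 by rewrite Rabs_pos_eq in w0.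
have := grid_correlation_lt psi _ _ ths mu w v l0 K hmu mu0 gap inj grid.
move=> h hle; exfalso; apply: (Rlt_not_le _ _ (h _ _ _)) => //.
by move=> l; rewrite -(Rabs_pos_eq (w l0)) //; apply: hw.
Qed.

(** * Residuals as combinations of atoms *)

Lemma hinner_zero (H : RHilbert) (z : H) : hinner (hzero H) z = 0.
Proof. by have := hinner_add (hzero H) (hzero H) z; rewrite hadd_0; lra. Qed.

Lemma hinner_sub (H : RHilbert) (x y z : H) :
  hinner (hsub x y) z = hinner x z - hinner y z.
Proof.
rewrite /hsub hinner_add.
by have := hinner_add y (hopp y) z; rewrite hadd_opp hinner_zero; lra.
Qed.

Lemma hinner_sum (H : RHilbert) (I : finType) (P : pred I) (F : I -> H) (z : H) :
  hinner (\big[@hadd H/hzero H]_(i | P i) F i) z = \rsum_(i | P i) hinner (F i) z.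
Proof.
by apply: (big_morph (fun x => hinner x z)) => [x y|]; [apply: hinner_add|apply: hinner_zero].
Qed.

(** Weak form of [x = sum_l w l * a (ths l)]: residuals are only ever tested through inner
    products. *)
Definition atoms_expansion (H : RHilbert) {D k : nat} (a : point D -> H)
    (ths : 'I_k -> point D) (x : H) (w : 'I_k -> R) : Prop :=
  forall z, hinner x z = \rsum_(l | true) (w l * hinner (a (ths l)) z).

(** The list may repeat an atom, so coefficients accumulate on each index. *)
Lemma lincomb_expansion (H : RHilbert) (D k : nat) (a : point D -> H)
  (ths : 'I_k -> point D) (cs : list R) (sel : list (point D)) :
  (forall t, List.In t sel -> exists l, t = ths l) ->
  exists2 w, atoms_expansion H a ths (lincomb a cs sel) w &
    forall l, ~ List.In (ths l) sel -> w l = 0.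
Proof.
elim: sel cs => [|t sel IH] [|c cs] hsel /=; try by
  exists (fun _ => 0) => // z; rewrite hinner_zero; apply: esym; apply: big1 => l _; ring.
have [|w hw w0] := IH cs; first by move=> u hu; apply: hsel; right.
have [l0 ->] := hsel t (or_introl erefl).
exists (fun l => (if l == l0 then c else 0) + w l) => [z|l hl].
  rewrite hinner_add hinner_scal hw.
  rewrite [RHS](eq_bigr (fun l => (if l == l0 then c else 0) * hinner (a (ths l)) z
    + w l * hinner (a (ths l)) z)); last by move=> l _ /=; ring.
  rewrite big_split /=; congr (_ + _); rewrite (bigD1 l0) //= eqxx big1; first by rewrite Rplus_0_r.
  by move=> i /negPf ->; exact: Rmult_0_l.
case: eqP => [E|_]; first by case: hl; left; rewrite E.
by rewrite w0; [ring|move=> h; apply: hl; right].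
Qed.

(** Weights vanishing off [S] keep the next selection in [S]; an unselected atom keeping its
    coefficient [c l] prevents the residual from vanishing. *)
Lemma residual_expansion (H : RHilbert) (D k : nat) (a : point D -> H)
  (ths : 'I_k -> point D) (S : {set 'I_k}) (c : 'I_k -> R) (cs : list R)
  (sel : list (point D)) :
  (forall t, List.In t sel -> exists2 l, l \in S & t = ths l) -> injective ths ->
  exists w, [/\ atoms_expansion H a ths
     (hsub (\big[@hadd H/hzero H]_(l in S) hscal (c l) (a (ths l))) (lincomb a cs sel)) w,
     forall l, l \notin S -> w l = 0 &
     forall l, l \in S -> ~ List.In (ths l) sel -> w l = c l].
Proof.
move=> hsel inj.
have [|w hw w0] := lincomb_expansion H D k a ths cs sel.
  by move=> t /hsel [l _ ->]; exists l.
exists (fun l => (if l \in S then c l else 0) - w l); split=> [z|l lS|l lS hl].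
- rewrite hinner_sub hinner_sum hw big_mkcond /=.
  have -> : forall x y : R, x - y = x + -1 * y by move=> *; ring.
  rewrite big_distrr -big_split; apply: eq_bigr => l _ /=.
  by case: ifP => _; rewrite ?hinner_scal; ring.
- rewrite (negPf lS) w0; first by ring.
  by move=> /hsel [l' l'S /inj E]; rewrite E l'S in lS.
- by rewrite lS w0 //; ring.
Qed.

(** * Coordinate gaps *)

Lemma List_in_flatten (T : Type) (I : eqType) (s : seq I) (F : I -> seq T) (i : I) (x : T) :
  i \in s -> List.In x (F i) -> List.In x (flatten [seq F j | j <- s]).
Proof.
move=> + hx; elim: s => //= j s IH; rewrite inE => /orP [/eqP <-|/IH h];
  apply/List.in_or_app; [by left|by right].
Qed.

Lemma List_in_map (T : Type) (I : eqType) (s : seq I) (F : I -> T) (i : I) :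
  i \in s -> List.In (F i) [seq F j | j <- s].
Proof.
by elim: s => //= j s IH; rewrite inE => /orP [/eqP <-|/IH h]; [left|right].
Qed.

Lemma gaps_in (D k : nat) (ths : 'I_k -> point D) (l l' : 'I_k) (d : 'I_D) :
  ths l d <> ths l' d -> List.In (Rabs (ths l d - ths l' d)) (gaps ths).
Proof.
move=> ll; apply: (List_in_flatten _ _ _ _ d); first by rewrite mem_enum.
apply: (List_in_flatten _ _ _ _ l); first by rewrite mem_enum.
apply: (List_in_map _ _ _ (fun l' => Rabs (ths l d - ths l' d)) l').
by rewrite mem_filter mem_enum; case: Req_EM_T.
Qed.

Lemma Delta0_le (D k : nat) (ths : 'I_k -> point D) (x : R) :
  List.In x (gaps ths) -> exists2 d0, Delta0 ths = Some d0 & d0 <= x.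
Proof.
rewrite /Delta0; elim: (gaps ths) => //= y s IH [->|/IH [d0 -> d0x]].
  by case: foldr => [m|]; [exists (Rmin x m) => //; apply: Rmin_l|exists x => //; lra].
by exists (Rmin y d0) => //; apply: Rle_trans (Rmin_r _ _) d0x.
Qed.

(** * Exact recovery by OMP *)

Theorem theorem5 (H : RHilbert) (D k : nat) (lam p : R) (a : point D -> H)
  (hlam : 0 < lam) (hp0 : 0 < p) (hp1 : p <= 1)
  (ha : forall t t' : point D, hinner (a t) (a t') = exp (- lam * normpp (psub t t') p))
  (ths : 'I_k -> point D) (hinj : injective ths)
  (hsep : match Delta0 ths with
          | None => True
          | Some d0 => powp d0 p >= ln (2 * INR k - 1) / lam
          end) :
  forall S : {set 'I_k}, omp_exact_recovery a ths S.
Proof.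
move=> S c c0 sel [reach res].
pose psi t := exp (- lam * powp t p).
have K : cusp_kernel psi by exact: exp_powp_cusp.
have haK u v : hinner (a u) (a v) = prod_kernel psi u v.
  rewrite ha /normpp; apply: (big_morph (fun x => exp (- lam * x))) => [x y|].
    by rewrite -exp_plus; f_equal; ring.
  by rewrite Rmult_0_r exp_0.
have expansion_correlation x w v : atoms_expansion H a ths x w ->
    hinner (a v) x = correlation psi ths w v.
  by move=> hx; rewrite hinner_sym hx; apply: eq_bigr => l _; rewrite haK.
pose mu := / (2 * INR k - 1).
(* For [k = 0] the number [mu] is negative, so these facts take an index [l] as witness of
   [k >= 1]. *)
have k1 (l : 'I_k) : 1 <= INR k.
  by have /ltP/le_INR := ltn_ord l; rewrite S_INR; have := pos_INR l; lra.
have hmu (l : 'I_k) : (2 * INR k - 1) * mu = 1.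
  by rewrite /mu; field; have := k1 l; lra.
have mu0 (l : 'I_k) : 0 < mu by apply: Rinv_0_lt_compat; have := k1 l; lra.
have gap l l' d : ths l d <> ths l' d -> psi (Rabs (ths l d - ths l' d)) <= mu.
  move=> /gaps_in /Delta0_le [d0 E d0x]; rewrite E in hsep.
  have := powp_le _ _ p hp0 d0x; set P := powp (Rabs _) p => hP.
  have hl : ln (2 * INR k - 1) <= lam * P.
    have -> : ln (2 * INR k - 1) = lam * (ln (2 * INR k - 1) / lam) by field; lra.
    by apply: Rmult_le_compat_l; lra.
  have -> : mu = exp (- ln (2 * INR k - 1)).
    by rewrite exp_Ropp exp_ln //; have := k1 l; lra.
  rewrite /psi -/P; have : - lam * P <= - ln (2 * INR k - 1) by lra.
  by case=> [/exp_increasing|->]; lra.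
(* Induction on the run: a nonzero residual has a nonzero weight, and any maximizer is then an atom
   of nonzero weight, hence of [S]. *)
have selS : forall t, List.In t sel -> exists2 l, l \in S & t = ths l.
  elim: {res} reach => [//|{}sel r t _ IH [[cs [_ Er]] _] r0 rmax] u.
  move=> /(@List.in_app_or _ _ _ _) [/IH //|[<- {u}|//]].
  have [w [hw wS _]] := residual_expansion H D k a ths S c cs sel IH hinj.
  rewrite -Er in hw.
  have [l1 _ wl1] : exists2 l, true & w l <> 0.
    apply: (exists_weight_neq0 _ _ _ (fun l => hinner (a (ths l)) r)).
    by rewrite -hw => /hinner_def.
  have [|l [wl ->]] := argmax_in_support psi D k ths mu w t l1 K (hmu l1) (mu0 l1) gap hinj wl1.
    by move=> v; rewrite -!(expansion_correlation r).
  exists l => //; apply/negPn/negP => /wS; exact: wl.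
move=> t; split=> [/selS [l lS ->]|[l [lS ->]]]; first by exists l.
(* If [ths l] were unselected, the zero residual would carry the weight [c l], nonzero, against the
   bound of [correlation_max_weight]. *)
have [[cs [_ Er]] _] := res.
have [w [hw _ wc]] := residual_expansion H D k a ths S c cs sel selS hinj.
rewrite -Er in hw.
have [//|nsel] := classic (List.In (ths l) sel).
have wl : w l <> 0 by rewrite wc //; apply: c0.
have [l0 _ hmax] := finite_argmax _ predT (fun l => Rabs (w l)) l isT.
have := correlation_max_weight psi D k ths mu w l0 K (hmu l) (mu0 l) gap hinj (fun l => hmax l isT).
rewrite -(expansion_correlation _ _ _ hw) hinner_sym hinner_zero Rabs_R0 => h.
have := hmax l isT; have := Rabs_pos_lt _ wl; rewrite /= => h1 h2.
have : 0 < INR k * mu * Rabs (w l0).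
  apply: Rmult_lt_0_compat; last lra.
  by apply: Rmult_lt_0_compat (mu0 l); have := k1 l; lra.
lra.
Qed.
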